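(* Let $n,d\ge 1$ be integers, let $\mathcal{X}\in \mathbf{S}^{n^{2d}}$ be a real super-symmetric tensor of order $2d$ and dimension $n$, and let $X=\boldsymbol{M}(\mathcal{X})\in\mathbb{R}^{n^d\times n^d}$ be its square matricization. Then $$\operatorname{rank}(\mathcal{X})=1\iff \operatorname{rank}(X)=1,$$ where $\operatorname{rank}(\mathcal{X})$ is the (symmetric real) CP rank of $\mathcal{X}$ and $\operatorname{rank}(X)$ is the usual matrix rank.
   Context: A real tensor $\mathcal{X}=(\mathcal{X}_{i_1\cdots i_m})_{1\le i_1,\dots,i_m\le n}$ is super-symmetric if its entries are invariant under all permutations of the indices $(i_1,\dots,i_m)$; $\mathbf{S}^{n^m}$ denotes the space of super-symmetric tensors of order $m$ and dimension $n$. The outer product of vectors is $(x^1\otimes\cdots\otimes x^m)_{i_1\cdots i_m}=\prod_{k=1}^m (x^k)_{i_k}$. CP rank: for $\mathcal{F}\in\mathbf{S}^{n^m}$, $\operatorname{rank}(\mathcal{F})$ is the smallest integer $r\ge 0$ such that $\mathcal{F}=\sum_{i=1}^r\lambda_i\,\underbrace{a^i\otimes\cdots\otimes a^i}_{m}$ for some $a^i\in\mathbb{R}^n$ and $\lambda_i\in\{1,-1\}$ (the empty sum being the zero tensor). Square matricization: for $\mathcal{F}\in\mathbf{S}^{n^{2d}}$, $\boldsymbol{M}(\mathcal{F})\in\mathbb{R}^{n^d\times n^d}$ is defined by $\boldsymbol{M}(\mathcal{F})_{k\ell}=\mathcal{F}_{i_1\cdots i_d i_{d+1}\cdots i_{2d}}$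 with $k=\sum_{j=1}^d(i_j-1)n^{d-j}+1$ and $\ell=\sum_{j=d+1}^{2d}(i_j-1)n^{2d-j}+1$, for $1\le i_1,\dots,i_{2d}\le n$. *)

(* Defs.v *)
From mathcomp Require Import all_boot all_order all_fingroup all_algebra.
From mathcomp Require Import reals.

Set Implicit Arguments.
Unset Strict Implicit.
Unset Printing Implicit Defensive.

Import Order.TTheory GRing.Theory Num.Theory.
Local Open Scope ring_scope.

(* Indices are 0-based: a multi-index (i_1, ..., i_m) is an m.-tuple of
   elements of {0, ..., n-1}, and its component i_j is [tnth i (j-1)].
   R^o is R seen as a module over itself, so that tensors can be scaled. *)
Notation tensor R m n := {ffun m.-tuple 'I_n -> R^o}.

Definition super_symmetric (R : realType) (m n : nat) (F : tensor R m n) :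
    Prop :=
  forall (s : 'S_m) (i : m.-tuple 'I_n),
    F [tuple tnth i (s k) | k < m] = F i.

Definition outer (R : realType) (m n : nat) (x : 'I_m -> 'rV[R]_n) :
    tensor R m n :=
  [ffun i : m.-tuple 'I_n => \prod_(k < m) x k 0 (tnth i k)].

Definition cp_decomposable (R : realType) (m n : nat) (F : tensor R m n)
    (r : nat) : Prop :=
  exists (lam : 'I_r -> R) (a : 'I_r -> 'rV[R]_n),
    (forall i, lam i = 1 \/ lam i = -1) /\
    F = \sum_(i < r) lam i *: outer (fun _ : 'I_m => a i).

(* [is_cp_rank F r] reads "rank(F) = r". *)
Definition is_cp_rank (R : realType) (m n : nat) (F : tensor R m n)
    (r : nat) : Prop :=
  cp_decomposable F r /\ forall s : nat, cp_decomposable F s -> (r <= s)%N.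

Definition flat (d n : nat) (i : d.-tuple 'I_n) : nat :=
  (\sum_(j < d) tnth i j * n ^ (d - j.+1))%N.

Lemma flat_cons (d n : nat) (i : d.+1.-tuple 'I_n) :
  flat i = (thead i * n ^ d + flat [tuple of behead i])%N.
Proof.
rewrite /flat big_ord_recl subSS subn0; congr (_ + _)%N.
apply: eq_bigr => j _; rewrite tnth_behead; congr (tnth i _ * _)%N.
by apply: val_inj; rewrite /= inordK // ltnS ltn_ord.
Qed.

Lemma flat_lt (d n : nat) (i : d.-tuple 'I_n) : (flat i < n ^ d)%N.
Proof.
elim: d i => [|d IH] i; first by rewrite /flat big_ord0.
rewrite flat_cons expnS.
have lt_i := ltn_ord (thead i).
apply: (@leq_trans ((thead i).+1 * n ^ d)); last by rewrite leq_mul2r lt_i orbT.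
by rewrite mulSn addnC ltn_add2r IH.
Qed.

Definition flat_index (d n : nat) (i : d.-tuple 'I_n) : 'I_(n ^ d) :=
  Ordinal (flat_lt i).

Lemma digit_lt (d n : nat) (k : 'I_(n ^ d)) (j : 'I_d) :
  ((k %/ n ^ (d - j.+1)) %% n < n)%N.
Proof.
rewrite ltn_mod; case: n k => // k.
by case: k => k; rewrite exp0n // (leq_trans _ (ltn_ord j)).
Qed.

(* The inverse of [flat_index]: base-n digits, most significant first. *)
Definition multi_index (d n : nat) (k : 'I_(n ^ d)) : d.-tuple 'I_n :=
  [tuple Ordinal (digit_lt k j) | j < d].

Lemma digit_flat (d n : nat) (i : d.-tuple 'I_n) (j : 'I_d) :
  ((flat i %/ n ^ (d - j.+1)) %% n)%N = tnth i j.
Proof.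
elim: d i j => [|d IH] i j; first by case: j.
have n_gt0 : (0 < n)%N by apply: leq_trans (ltn_ord (tnth i j)).
rewrite flat_cons subSS.
case: (unliftP ord0 j) => [j'|] -> /=.
  have le_d : (j'.+1 <= d)%N by [].
  rewrite -[in (n ^ d)%N](subnK le_d) expnD mulnCA [X in (X + _)%N]mulnC /bump /= add1n.
  rewrite divnMDl ?expn_gt0 ?n_gt0 //.
  rewrite expnS mulnCA mulnC modnMDl.
  rewrite (IH [tuple of behead i] j') tnth_behead; congr (val (tnth i _)).
  by apply: val_inj; rewrite /= inordK // ltnS.
rewrite subn0 divnMDl ?expn_gt0 ?n_gt0 // divn_small ?flat_lt // addn0.
by rewrite modn_small.
Qed.

Lemma flat_indexK (d n : nat) : cancel (@flat_index d n) (@multi_index d n).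
Proof.
move=> i; apply: eq_from_tnth => j; rewrite tnth_mktuple.
by apply: val_inj; rewrite /= digit_flat.
Qed.

Lemma flat_index_bij (d n : nat) : bijective (@flat_index d n).
Proof.
apply: inj_card_bij; first exact: can_inj (@flat_indexK d n).
by rewrite card_tuple !card_ord.
Qed.

(* Square matricization; by [matricizationE] below its entry at
   (flat_index i, flat_index j) is F_{i_1 ... i_d j_1 ... j_d}. *)
Definition matricization (R : realType) (d n : nat) (F : tensor R (d + d) n) :
    'M[R]_(n ^ d) :=
  \matrix_(k, l) F [tuple of multi_index k ++ multi_index l].

Lemma matricizationE (R : realType) (d n : nat) (F : tensor R (d + d) n)
    (i j : d.-tuple 'I_n) :
  matricization F (flat_index i) (flat_index j) = F [tuple of i ++ j].
Proof. by rewrite mxE !flat_indexK. Qed.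

(* Main.v *)
(** Vanishing of the 2x2 minors of the matricization, combined with symmetry,
    shows that an index can be exchanged between two entries:
    X(x,s) X(y,t) = X(y,s) X(x,t) for all s, t of length 2d-1.  If
    X(p,r) != 0, taking (y,t) = (p,r) lets one replace the indices of any
    entry by p one at a time, whence X(w) = X(p,...,p) \prod_k b(w_k) with
    b(q) = X(q,r) / X(p,r).  The constant X(p,...,p) is absorbed, up to its
    sign, by a real 2d-th root. *)
Require Import Defs.
From mathcomp Require Import all_boot all_order all_fingroup all_algebra.
From mathcomp Require Import reals.

Set Implicit Arguments.
Unset Strict Implicit.
Unset Printing Implicit Defensive.

Import Order.TTheory GRing.Theory Num.Theory.
Local Open Scope ring_scope.

(** Intermediate value theorem for ['X^m - c] on [[0, c + 1]]: the value at 0 is [- c], and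
    [(c + 1)^m >= c + 1 >= c]. *)
Lemma nth_root_exists (R : rcfType) (m : nat) (c : R) :
  (0 < m)%N -> 0 <= c -> exists r : R, r ^+ m = c.
Proof.
move=> m_gt0 c_ge0.
have c1_ge0 : 0 <= c + 1 by rewrite addr_ge0.
have [|r _ /rootP] := @poly_ivt R ('X^m - c%:P) 0 (c + 1) c1_ge0.
  rewrite !hornerE expr0n gtn_eqF // sub0r oppr_le0 c_ge0 subr_ge0.
  by rewrite (@le_trans _ _ (c + 1)) ?lerDl // ler_eXnr ?lerDr.
by rewrite !hornerE => /eqP; rewrite subr_eq0 => /eqP; exists r.
Qed.

Lemma mxrank1P (F : fieldType) (m n : nat) (A : 'M[F]_(m, n)) :
  \rank A = 1%N -> exists (u : 'cV_m) (v : 'rV_n), A = u *m v.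
Proof.
(* In the full-rank factorization of [A] the inner dimension is [\rank A], here 1. *)
move=> rkA; have := mulmx_base A.
by move: (col_base A) (row_base A); rewrite rkA => u v <-; exists u, v.
Qed.

Lemma exchange_prod (R : fieldType) (T : eqType) (m : nat) (f : seq T -> R)
    (p : T) (r : seq T) :
    (forall s t, size s = m.+1 -> perm_eq s t -> f s = f t) ->
    (forall x y s t, size s = m -> size t = m ->
       f (x :: s) * f (y :: t) = f (y :: s) * f (x :: t)) ->
    size r = m -> f (p :: r) != 0 ->
  forall w, size w = m.+1 ->
  f w = f (nseq m.+1 p) * \prod_(q <- w) (f (q :: r) / f (p :: r)).
Proof.
move=> f_perm f_exch sz_r fpr_neq0.
(* Induction on the part of the word not yet replaced: the head [q] of [w] joins the block of [p]s
   at the cost of the factor [f (q :: r) / f (p :: r)]. *)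
suff gen w k : (k + size w = m.+1)%N ->
    f (nseq k p ++ w)
      = f (nseq m.+1 p) * \prod_(q <- w) (f (q :: r) / f (p :: r)).
  by move=> w sz_w; apply: (gen w 0).
elim: w k => [|q w IHw] k /=.
  by rewrite addn0 => ->; rewrite cats0 big_nil mulr1.
rewrite addnS => -[sz_w]; rewrite big_cons mulrCA -(IHw k.+1) ?addSn ?sz_w //=.
have sz_kw : size (nseq k p ++ w) = m by rewrite size_cat size_nseq.
rewrite (f_perm _ (q :: nseq k p ++ w)); first last.
- by rewrite perm_catC /= perm_cons perm_catC.
- by rewrite size_cat size_nseq /= addnS sz_w.
by rewrite mulrAC mulrC [f (q :: r) * _]mulrC -f_exch // mulrCA mulVf ?mulr1.
Qed.

Lemma super_symmetric_perm (R : realType) (m n : nat) (F : tensor R m n)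
    (i j : m.-tuple 'I_n) :
  super_symmetric F -> perm_eq i j -> F i = F j.
Proof.
move=> symF /tuple_permP[s eq_i]; rewrite -(symF s j).
by congr (F _); apply: val_inj.
Qed.

(** Every index of length 2d splits into two halves, so each entry of the tensor occurs in the
    matrix. This transfers nonvanishing from [X] to its matricization. *)
Lemma matricization_inj (R : realType) (n d : nat) :
  injective (@matricization R d n).
Proof.
move=> F G eqFG; apply/ffunP => w.
have sz_t : size (take d w) == d by rewrite size_takel // size_tuple leq_addr.
have sz_d : size (drop d w) == d by rewrite size_drop size_tuple addKn.
have -> : w = [tuple of Tuple sz_t ++ Tuple sz_d].
  by apply: val_inj; rewrite /= cat_take_drop.
by rewrite -!matricizationE eqFG.
Qed.

Lemma cp_decomposable0 (R : realType) (m n : nat) (F : tensor R m n) :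
  cp_decomposable F 0 <-> F = 0.
Proof.
split=> [[lam [a [_ ->]]]|->]; first by rewrite big_ord0.
exists (fun=> 1), (fun=> 0); split=> [[]//|]; by rewrite big_ord0.
Qed.

Lemma is_cp_rank1 (R : realType) (m n : nat) (F : tensor R m n) :
  is_cp_rank F 1 <-> cp_decomposable F 1 /\ F <> 0.
Proof.
split=> -[dF H]; split=> //.
  by move=> /cp_decomposable0/H.
by move=> [/cp_decomposable0|].
Qed.

Lemma cp_decomposable_prod (R : realType) (m n : nat) (F : tensor R m n)
    (c : R) (b : 'I_n -> R) :
    (0 < m)%N -> (forall w, F w = c * \prod_(k < m) b (tnth w k)) ->
  cp_decomposable F 1.
Proof.
move=> m_gt0 defF; have [e def_e] := nth_root_exists m_gt0 (normr_ge0 c).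
(* Each of the [m] factors carries one [e], and [e ^+ m] is the absolute value of [c]; the sign goes
   into [lam]. *)
exists (fun=> (-1) ^+ (c < 0)%R), (fun=> \row_q (e * b q)); split.
  by move=> _; case: (c < 0)%R; [right | left].
apply/ffunP => w; rewrite big_ord1 !ffunE defF.
under [in RHS]eq_bigr do rewrite mxE.
rewrite big_split /= prodr_const card_ord def_e.
by rewrite [RHS]mulrA mulr_sign_norm.
Qed.

Lemma matricization_cp1_rank (R : realType) (n d : nat)
    (X : tensor R (d + d) n) :
  cp_decomposable X 1 -> (\rank (matricization X) <= 1)%N.
Proof.
move=> [lam [a [_ defX]]].
(* [g] is the flattened d-th tensor power of the vector; the 2d-th power matricizes to a column
   times a row. *)
pose g (k : 'I_(n ^ d)) := \prod_(j < d) a ord0 0 (tnth (multi_index k) j).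
have -> : matricization X = (\col_k (lam ord0 * g k)) *m (\row_l g l).
  apply/matrixP => k l; rewrite !mxE defX !big_ord1 !ffunE !mxE -mulrA.
  congr (_ * _); rewrite big_split_ord /=.
  by congr (_ * _); apply: eq_bigr => j _; rewrite ?tnth_lshift ?tnth_rshift.
exact: leq_trans (mxrankM_maxl _ _) (rank_leq_col _).
Qed.

Lemma matricization_rank1_cp (R : realType) (n d : nat)
    (X : tensor R (d.+1 + d.+1) n) :
  super_symmetric X -> \rank (matricization X) = 1%N -> cp_decomposable X 1.
Proof.
move=> symX rkX.
have [w0 Xw0] : exists w0, X w0 != 0.
  apply/existsP; apply: contra_eqT rkX; rewrite negb_exists => /forallP X0.
  have -> : matricization X = 0.
    by apply/matrixP => k l; rewrite !mxE; apply/eqP; rewrite -[_ == _]negbK.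
  by rewrite mxrank0.
pose m := (d + d.+1)%N.
(* Junk value [X w0] on sequences of the wrong length. *)
pose f s := X (insubd w0 s).
have f_tuple (w : (d.+1 + d.+1).-tuple 'I_n) : f w = X w by rewrite /f valKd.
have f_perm s t : size s = m.+1 -> perm_eq s t -> f s = f t.
  move=> sz_s eq_st; apply: super_symmetric_perm => //.
  by rewrite !val_insubd -(perm_size eq_st) sz_s eqxx.
have [u [v defM]] := mxrank1P rkX.
(* The constant tuple is only a default for sequences whose length is not [d.+1]. *)
pose g (s : seq 'I_n) := flat_index (insubd (nseq_tuple d.+1 (thead w0)) s).
have f_cat s t : size s = d.+1 -> size t = d.+1 ->
    f (s ++ t) = u (g s) 0 * v 0 (g t).
  move=> sz_s sz_t.
  have := matricizationE X (insubd (nseq_tuple _ (thead w0)) s)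
    (insubd (nseq_tuple _ (thead w0)) t).
  rewrite defM mxE big_ord1 => ->; rewrite -f_tuple /=.
  by rewrite !val_insubd sz_s sz_t !eqxx.
have f_minor a b c e : size a = d.+1 -> size b = d.+1 -> size c = d.+1 ->
    size e = d.+1 -> f (a ++ b) * f (c ++ e) = f (a ++ e) * f (c ++ b).
  by move=> *; rewrite !f_cat // mulrACA [v 0 _ * _]mulrC mulrACA.
have f_exch x y s t : size s = m -> size t = m ->
    f (x :: s) * f (y :: t) = f (y :: s) * f (x :: t).
  have split_m r : size r = m -> exists r1 r2,
      [/\ r = r1 ++ r2, size r1 = d & size r2 = d.+1].
    move=> sz_r; exists (take d r), (drop d r); rewrite cat_take_drop.
    by rewrite size_drop size_takel sz_r ?leq_addr // addKn.
  move=> /split_m[s1 [s2 [-> sz1 sz2]]] /split_m[t1 [t2 [-> sz3 sz4]]].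
  (* By symmetry [r2] can serve as the row index and [z :: r1] as the column index. *)
  have rot z r1 r2 : size r1 = d -> size r2 = d.+1 ->
      f (z :: (r1 ++ r2)) = f (r2 ++ z :: r1).
    move=> sz_r1 sz_r2; apply: f_perm; first by rewrite /= size_cat sz_r1 sz_r2.
    by rewrite -cat_cons perm_catC.
  (* With rows s2, (y,t1) and columns (x,s1), t2, the minor brings x, s1, y, t1
     into a single entry, where x and y can be swapped by symmetry. *)
  rewrite [f (x :: s1 ++ s2)]rot // [f (y :: s1 ++ s2)]rot //.
  rewrite (f_minor s2 (x :: s1) (y :: t1) t2) ?(f_minor s2 _ (x :: t1) t2) /=
    ?sz1 ?sz3 //; congr (_ * _).
  apply: f_perm; first by rewrite /= size_cat /= sz1 sz3.
  apply/seq.permP => a; rewrite -!cat_cons !count_cat /=.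
  by rewrite addnACA [RHS]addnACA [(a x + _)%N]addnC.
(* The pivot [p :: r] is the nonzero entry [w0], cut into head and tail. *)
have Xpr : f (thead w0 :: behead w0) != 0.
  suff -> : thead w0 :: behead w0 = w0 by rewrite f_tuple.
  by rewrite [in RHS](tuple_eta w0).
have sz_b : size (behead w0) = m by rewrite size_behead size_tuple.
have defX := exchange_prod f_perm f_exch sz_b Xpr.
apply: (@cp_decomposable_prod _ _ _ _ _
  (fun q => f (q :: behead w0) / f (thead w0 :: behead w0))) => // w.
by rewrite -f_tuple defX ?size_tuple // big_tuple.
Qed.

Theorem theorem2p4 (R : realType) (n d : nat) (hn : (1 <= n)%N)
  (hd : (1 <= d)%N) (X : tensor R (d + d) n) (hX : super_symmetric X) :
  is_cp_rank X 1%N <-> \rank (matricization X) = 1%N.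
Proof.
case: d hd X hX => // d _ X symX.
have M0 : matricization (0 : tensor R (d.+1 + d.+1) n) = 0.
  by apply/matrixP => k l; rewrite !mxE ffunE.
split=> [/is_cp_rank1[cpX X_neq0] | rkX].
  apply/eqP; rewrite eqn_leq matricization_cp1_rank //= lt0n mxrank_eq0.
  by apply/eqP; rewrite -M0 => /matricization_inj.
apply/is_cp_rank1; split; first exact: matricization_rank1_cp.
by move=> X0; rewrite X0 M0 mxrank0 in rkX.
Qed.
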